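(* Let $\Theta:\mathbb{Z}\to\mathbb{R}$ be a real-valued function. Let $\psi_n^{\Theta(\cdot)}$ be the $n$-th step state of the quantum walk on $\mathbb{Z}$ with site-dependent coin $C=\sum_{x\in\mathbb{Z}}e_xe_x^*\otimes e^{i\Theta(x)\sigma_1}$ and initial state $\psi_0$. Then for every $x\in\mathbb{Z}$, $z=\pm1$ and initial state $\psi_0\in\ell^2(\mathbb{Z})\otimes\ell^2(\{\pm1\})$, and every $n\ge1$, $$\psi_n^{\Theta(\cdot)}(x,z)=\mathbb{E}\left[i^{S_n}e^{\Theta(X_1)+\cdots+\Theta(X_n)}\psi_0(X_n,Z_n)\right],$$ where $(S_n,Z_n,X_n)$ is the process defined in the context, started from $(S_0,Z_0,X_0)=(0,z,x)$, whose driving random variables $(N_j)_{j\ge1}$ are defined by $$N_j\mid\mathcal{F}_{j-1}\sim\mathrm{Poisson}(\Theta(X_j)),\qquad \mathcal{F}_j:=\sigma(N_1,\dots,N_j),\qquad\text{for every } j\ge1.$$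
   Context: Quantum walk: on $\ell^2(\mathbb{Z}\times\{\pm1\})\cong\ell^2(\mathbb{Z})\otimes\ell^2(\{\pm1\})$ with orthonormal basis $e_xe_z$ and $\psi=\sum_{x,z}\psi(x,z)e_xe_z$, the walk operator is $W=SC$ with $C$ the coin operator and $Se_xe_z=e_{x+z}e_z$; $\psi_n=W\psi_{n-1}$ for $n\ge1$. In the ordered basis $(e_1,e_{-1})$, $e^{i\theta\sigma_1}=\begin{bmatrix}\cos\theta&i\sin\theta\\ i\sin\theta&\cos\theta\end{bmatrix}$. Process: $S_0=0$, $S_n=\sum_{j=1}^nN_j\pmod4\in\{0,1,2,3\}$; $Z_0=z$, $Z_n=(-1)^{S_n}z$; $X_0=x$, $X_n=X_{n-1}-Z_{n-1}=x-\sum_{j=0}^{n-1}Z_j$ for $n\ge1$ (so $X_j$ is determined by $N_1,\dots,N_{j-1}$). $\mathcal F_0$ is the trivial $\sigma$-algebra.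
   Formalization: Since a Poisson law needs a nonnegative parameter, the hypothesis N_j | F_{j-1} ~ Poisson(Θ(X_j)) is taken to include Θ(X_j) ≥ 0 almost surely for every j ≥ 1; for Θ negative at a visited site (e.g. Θ ≡ −1) the process in the statement does not exist. *)

(* Defs.v *)
From HB Require Import structures.
From mathcomp Require Export all_boot all_order all_algebra.
From mathcomp Require Export all_classical all_reals all_analysis.
From mathcomp Require Export measurable_realfun complex.

Set Implicit Arguments.
Unset Strict Implicit.
Unset Printing Implicit Defensive.

Import Order.TTheory GRing.Theory Num.Theory.

Local Open Scope classical_set_scope.
Local Open Scope ring_scope.
Local Open Scope complex_scope.

(* The two-point set {1, -1} is encoded by bool through z |-> (-1) ^+ z, so
   false stands for 1 and true for -1; flipping the sign is exclusive or. *)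
Notation spin := bool.

Definition sgn (z : spin) : int := (-1) ^+ z.

Section QuantumWalk.
Variable R : realType.

(* Amplitudes psi x z = psi(x, z) of a vector on Z x {1, -1}; square
   summability is the separate predicate ell2. *)
Definition state := int -> spin -> R[i].

Definition ell2 (psi : state) : Prop :=
  (\esum_(p in [set: int * spin])
     (ComplexField.Normc.normc (psi p.1 p.2) ^+ 2)%:E < +oo)%E.

(* e^{i theta sigma_1} in the ordered basis (e_1, e_{-1}) *)
Definition exp_isigma1 (theta : R) : 'M[R[i]]_2 :=
  \matrix_(j < 2, k < 2)
    if j == k then (cos theta)%:C else 'i%C * (sin theta)%:C.

(* position of e_z in the ordered basis (e_1, e_{-1}) *)
Definition spin_ord (z : spin) : 'I_2 := if z then ord_max else ord0.

(* C = sum_x e_x e_x^* (x) e^{i Theta(x) sigma_1} *)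
Definition coin_op (Theta : int -> R) (psi : state) : state := fun x z =>
  \sum_(z' : spin)
    exp_isigma1 (Theta x) (spin_ord z) (spin_ord z') * psi x z'.

(* S e_x e_z = e_{x+z} e_z, read on amplitudes; see shift_op_basis *)
Definition shift_op (psi : state) : state := fun x z => psi (x - sgn z) z.

Definition walk_op (Theta : int -> R) (psi : state) : state :=
  shift_op (coin_op Theta psi).

Definition walk (Theta : int -> R) (psi0 : state) (n : nat) : state :=
  iter n (walk_op Theta) psi0.

Definition basis_state (x : int) (z : spin) : state :=
  fun x' z' => ((x' == x) && (z' == z))%:R.

Lemma shift_op_basis (x : int) (z : spin) :
  shift_op (basis_state x z) = basis_state (x + sgn z) z.
Proof.
apply/funext => y; apply/funext => w; rewrite /shift_op /basis_state.
by case: (eqVneq w z) => [->|_]; rewrite ?andbF // !andbT subr_eq.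
Qed.

Lemma coin_op_basis (Theta : int -> R) (x : int) (z : spin) :
  coin_op Theta (basis_state x z) =
  fun y w => \sum_(z' : spin)
    exp_isigma1 (Theta x) (spin_ord z') (spin_ord z) * basis_state x z' y w.
Proof.
apply/funext => y; apply/funext => w; rewrite /coin_op /basis_state.
rewrite (bigD1 z) //= big1 ?addr0; last first.
  by move=> z' z'z; rewrite (negPf z'z) andbF mulr0.
rewrite (bigD1 w) //= big1 ?addr0; last first.
  by move=> z' z'w; rewrite [w == z']eq_sym (negPf z'w) andbF mulr0.
by rewrite !eqxx !andbT; case: eqP => [->|_] //; rewrite !mulr0.
Qed.

End QuantumWalk.

(* The driving variables are indexed from 1; N 0 is never used. *)
Section Process.
Variables (T : Type) (N : nat -> T -> nat) (x : int) (z : spin).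

Definition procS (n : nat) (w : T) : nat :=
  (\sum_(1 <= j < n.+1) N j w) %% 4.

(* (-1)^{S_n} z; see sgn_procZ *)
Definition procZ (n : nat) (w : T) : spin := odd (procS n w) (+) z.

Definition procX (n : nat) (w : T) : int :=
  x - \sum_(0 <= j < n) sgn (procZ j w).

Lemma sgn_procZ (n : nat) (w : T) :
  sgn (procZ n w) = (-1) ^+ procS n w * sgn z.
Proof. by rewrite /sgn /procZ signr_addb signr_odd. Qed.

Lemma procX0 (w : T) : procX 0 w = x.
Proof. by rewrite /procX big_geq // subr0. Qed.

Lemma procXS (n : nat) (w : T) :
  procX n.+1 w = procX n w - sgn (procZ n w).
Proof. by rewrite /procX big_nat_recr //= opprD addrA. Qed.

End Process.

Section Probability.
Context d (T : measurableType d) (R : realType) (P : probability T R).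

(* sigma(N_1, ..., N_j) *)
Definition natural_filtration (N : nat -> T -> nat) (j : nat) : set (set T) :=
  g_sigma_preimage (fun i : 'I_j => N i.+1).

(* mu is a regular conditional distribution of Y given the sub-sigma-algebra
   F: for all measurable B, mu w B is a version of P(Y \in B | F)(w). *)
Definition cond_law d' (T' : measurableType d') (F : set (set T))
    (Y : T -> T') (mu : T -> probability T' R) : Prop :=
  forall B : set T', measurable B ->
    (forall D : set (\bar R), measurable D -> F ((fun w => mu w B) @^-1` D)) /\
    (forall A : set T, F A ->
       P (A `&` Y @^-1` B) = (\int[P]_(w in A) mu w B)%E).

(* Y | F ~ Poisson(lambda). A Poisson law has a parameter >= 0 (Poisson(0)
   being the Dirac mass at 0), whereas the total function poisson_prob returns
   the Dirac mass at 0 on negative rates: the condition on lambda excludes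
   this. The second argument of poisson_prob is a dummy. *)
Definition cond_poisson (F : set (set T)) (Y : T -> nat) (lambda : T -> R) :
    Prop :=
  {ae P, forall w, 0 <= lambda w} /\
  cond_law F Y (fun w => poisson_prob (lambda w) 0).

Definition cintegrable (f : T -> R[i]) : Prop :=
  P.-integrable setT (EFin \o (fun w => complex.Re (f w))) /\
  P.-integrable setT (EFin \o (fun w => complex.Im (f w))).

Definition cexpectation (f : T -> R[i]) : R[i] :=
  fine 'E_P[fun w => complex.Re (f w)] +i* fine 'E_P[fun w => complex.Im (f w)].

End Probability.

(* Main.v *)
Require Import Defs.
From mathcomp Require Import ring.

(** The identity is a Feynman-Kac formula for one step of the walk, iterated.
    For [theta >= 0], expanding [e^{i theta sigma_1}] in powers of [sigma_1]
    gives
    [e^{i theta sigma_1} = e^theta * sum_k P(Poisson(theta) = k) i^k sigma_1^k],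
    so applying the coin at a site amounts to averaging, with weight [e^theta],
    over a Poisson number [k] of spin flips, each contributing a factor [i].
    Only [k] modulo 4 matters, since [i^4 = 1] and [sigma_1^2 = 1]; hence only
    the Poisson masses of the four residue classes enter.  They come in two
    pairs, whose differences are [e^{-theta} cos theta] and
    [e^{-theta} sin theta] ([poisson_twist]).

    The Markov structure is handled without conditional expectations.  Call a
    branch an event of the filtration at time [k] on which [S_k], [X_k], [Z_k]
    and the accumulated rate are all constant.  On a branch [X_{k+1}] is
    constant too, so the conditional law of [N_{k+1}] is one fixed Poisson law
    and the branch splits into four branches at time [k+1], according to
    [N_{k+1}] modulo 4, with explicitly known masses ([conditional_mass]).
    Induction on the number [m] of remaining steps then shows that the integral
    of the path functional over a branch is its probability times
    [i^{S_k} e^{rate} psi_m(X_k, Z_k)], where [psi_m] is the walk after [m]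
    steps ([path_functional_integral]).  The whole space is a branch at time 0,
    and for it this is the theorem.  The functional is constant on
    each of the finitely many final branches, whence its integrability.

    A branch whose next rate is negative is not covered by the Poisson
    expansion, but it is null because the rates are almost surely nonnegative
    ([rate_ge0]). *)

Set Implicit Arguments.
Unset Strict Implicit.
Unset Printing Implicit Defensive.

Import Order.TTheory GRing.Theory Num.Theory.
Import numFieldNormedType.Exports.

Local Open Scope classical_set_scope.
Local Open Scope ring_scope.
Local Open Scope complex_scope.

(** * Poisson masses of the residue classes modulo 4 *)

Section PoissonResidues.
Variable R : realType.
Implicit Types theta : R.

Definition residue4 (r : nat) : set nat := [set k | (k %% 4)%N = r].

Definition poisson_mass theta (B : set nat) : R :=
  fine (poisson_prob theta 0 B).

(** The factor [expR theta] cancels the normalisation of the Poisson law, so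
    that masses are compared with the power series of [cos] and [sin] term by
    term.  The case [theta = 0] is separate, the law being then defined as a
    Dirac mass. *)
Lemma poisson_mass_series theta (B : set nat) : 0 <= theta ->
  series (fun k => (k \in B)%:R * exp_coeff theta k) @ \oo -->
  expR theta * poisson_mass theta B.
Proof.
rewrite le_eqVlt => /predU1P[<-|th0].
  rewrite expR0 mul1r /poisson_mass /poisson_prob ltxx diracE /=.
  rewrite -(cvg_shiftS (series _)).
  apply: cvg_near_cst; apply: nearW => n.
  rewrite /series /= big_nat_recl //= big1 ?addr0; last first.
    by move=> i _; rewrite /exp_coeff /= expr0n mul0r mulr0.
  by rewrite /exp_coeff /= expr0 fact0 divr1 mulr1.
pose u k : \bar R := ((k \in B)%:R * exp_coeff theta k)%:E.
have sumE : (\sum_(0 <= k <oo) u k = (expR theta * poisson_mass theta B)%:E)%E.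
  rewrite EFinM /poisson_mass fineK ?fin_num_measure//.
  rewrite /poisson_prob th0 -(set_mem_set B) -nneseries_esum; last first.
    by move=> k _; rewrite lee_fin poisson_pmf_ge0.
  rewrite -nneseriesZl; last first.
    by move=> k _; rewrite lee_fin poisson_pmf_ge0.
  rewrite [RHS]eseries_mkcond; apply: eq_eseriesr => k _; rewrite /u.
  case: ifPn => _; last by rewrite mul0r.
  rewrite mul1r -EFinM /poisson_pmf th0 /exp_coeff /=; congr (_%:E).
  by rewrite expRN mulrCA mulfV ?mulr1// gt_eqF// expR_gt0.
have cvg_u : (\sum_(0 <= k < n) u k)%E @[n --> \oo] -->
    (expR theta * poisson_mass theta B)%:E.
  rewrite -sumE; apply: is_cvg_nneseries => k _ _.
  by rewrite lee_fin mulr_ge0 ?ler0n ?exp_coeff_ge0 ?ltW.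
apply: cvg_trans (fine_cvg cvg_u); apply: near_eq_cvg; apply: nearW => n /=.
by rewrite /u sumEFin.
Qed.

Lemma mem_residue4 (q r s : nat) : (r < 4)%N ->
  ((q * 4 + r)%N \in residue4 s) = (r == s).
Proof.
move=> r4; have rE : ((q * 4 + r) %% 4 = r)%N by rewrite modnMDl modn_small.
by apply/idP/eqP => [/set_mem|<-]; [rewrite /residue4 /= rE|exact/mem_set].
Qed.

Lemma signr_half4 (q r : nat) :
  (-1) ^+ (q * 4 + r)./2 = (-1) ^+ r./2 :> R.
Proof.
rewrite halfD oddM andbF /= (mulnA q 2 2) muln2 doubleK (mulnC q) add0n.
by rewrite exprD exprM sqrrN !expr1n mul1r.
Qed.

Lemma residue_gap_series theta (r s : nat) : 0 <= theta ->
  series (fun k => ((k \in residue4 r)%:R - (k \in residue4 s)%:R) *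
                   exp_coeff theta k) @ \oo -->
  expR theta * (poisson_mass theta (residue4 r) -
                poisson_mass theta (residue4 s)).
Proof.
move=> th0; rewrite mulrBr.
have /(_ eventually_filter) := cvgB (poisson_mass_series (B := residue4 r) th0)
                                    (poisson_mass_series (B := residue4 s) th0).
apply: cvg_trans; apply: near_eq_cvg; apply: nearW => n /=.
by rewrite !fctE /series /= -sumrB; apply: eq_bigr => k _; rewrite mulrBl.
Qed.

(** The real part of [i^k] is 1, 0, -1, 0 as [k] runs through the residues
    0, 1, 2, 3: these are the signs of the cosine series. *)
Lemma poisson_mass_cos theta : 0 <= theta ->
  expR theta *
    (poisson_mass theta (residue4 0) - poisson_mass theta (residue4 2)) =
  cos theta.
Proof.
move=> th0; apply/esym; rewrite unlock; apply: cvg_lim => //.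
rewrite (_ : cos_coeff theta = fun k =>
  ((k \in residue4 0)%:R - (k \in residue4 2)%:R) * exp_coeff theta k).
  exact: residue_gap_series.
apply/funext => k; rewrite /cos_coeff /= -!mulrA mulrA; congr (_ * _).
rewrite (divn_eq k 4); have : (k %% 4 < 4)%N by rewrite ltn_mod.
move: (k %/ 4)%N (k %% 4)%N => q r r4.
rewrite !mem_residue4// oddD oddM andbF addFb -exprnP.
move: r r4 => [|[|[|[|]]]] //= _; rewrite ?subrr ?mul0r// signr_half4//=.
  by ring.
by ring.
Qed.

(** Likewise for the imaginary part of [i^k] and the sine series. *)
Lemma poisson_mass_sin theta : 0 <= theta ->
  expR theta *
    (poisson_mass theta (residue4 1) - poisson_mass theta (residue4 3)) =
  sin theta.
Proof.
move=> th0; apply/esym; rewrite unlock; apply: cvg_lim => //.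
rewrite (_ : sin_coeff theta = fun k =>
  ((k \in residue4 1)%:R - (k \in residue4 3)%:R) * exp_coeff theta k).
  exact: residue_gap_series.
apply/funext => k; rewrite /sin_coeff /= -!mulrA mulrA; congr (_ * _).
rewrite (divn_eq k 4); have : (k %% 4 < 4)%N by rewrite ltn_mod.
move: (k %/ 4)%N (k %% 4)%N => q r r4.
rewrite !mem_residue4// oddD oddM andbF addFb.
(* the truncated predecessor in the sine series is only reached for odd [r] *)
move: r r4 => [|[|[|[|]]]] //= _;
  rewrite ?subrr ?mul0r// addnS /= signr_half4 /=.
  by ring.
by ring.
Qed.

(** One coin step as a Poisson average: [g false] and [g true] are the
    amplitudes of the unflipped and of the flipped spin. *)
Lemma poisson_twist theta (g : bool -> R[i]) : 0 <= theta ->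
  \sum_(r <- iota 0 4) (poisson_mass theta (residue4 r))%:C *
    ('i%C ^+ r * (expR theta)%:C * g (odd r)) =
  (cos theta)%:C * g false + 'i%C * (sin theta)%:C * g true.
Proof.
move=> th0; rewrite -(poisson_mass_cos th0) -(poisson_mass_sin th0).
rewrite !big_cons big_nil /= !rmorphM !rmorphB /=.
have -> : 'i%C ^+ 3 = - 'i%C :> R[i] by rewrite exprS sqr_i mulrN1.
rewrite sqr_i expr0 expr1; ring.
Qed.

End PoissonResidues.

(** * Integrals of complex functions over events *)

Section ComplexIntegral.
Context d (T : measurableType d) (R : realType) (P : probability T R).

(** Integrability and value are bundled because both propagate together
    through finite disjoint unions of events. *)
Definition integral_is (A : set T) (f : T -> R) (v : R) : Prop :=
  P.-integrable A (EFin \o f) /\ (\int[P]_(w in A) (f w)%:E)%E = v%:E.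

Definition cintegral_is (A : set T) (f : T -> R[i]) (v : R[i]) : Prop :=
  integral_is A (fun w => complex.Re (f w)) (complex.Re v) /\
  integral_is A (fun w => complex.Im (f w)) (complex.Im v).

Lemma integral_is_cst (A : set T) (f : T -> R) (c : R) : measurable A ->
  (forall w, A w -> f w = c) -> integral_is A f (fine (P A) * c).
Proof.
move=> mA fc; split.
  apply: (eq_integrable mA) (finite_measure_integrable_cst P c mA).
  by move=> w /set_mem Aw /=; rewrite fc.
rewrite (eq_integral (cst c%:E)); last by move=> w /set_mem Aw; rewrite fc.
by rewrite integral_cst// EFinM fineK ?fin_num_measure// muleC.
Qed.

Lemma integral_isU (A B : set T) (f : T -> R) (u v : R) :
  measurable A -> measurable B -> [disjoint A & B] ->
  integral_is A f u -> integral_is B f v -> integral_is (A `|` B) f (u + v).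
Proof.
move=> mA mB AB [iA eA] [iB eB].
have mf : measurable_fun (A `|` B) (EFin \o f).
  by apply/measurable_funU => //; split;
    [exact: measurable_int iA|exact: measurable_int iB].
split; last by rewrite integral_setU // eA eB.
apply/integrableP; split => //.
rewrite ge0_integral_setU //; last exact: measurableT_comp.
by apply: lte_add_pinfty; [case/integrableP: iA|case/integrableP: iB].
Qed.

Lemma cintegral_is_bigU (I : eqType) (s : seq I) (A : I -> set T)
    (f : T -> R[i]) (v : I -> R[i]) :
  (forall i, measurable (A i)) -> uniq s -> trivIset [set: I] A ->
  (forall i, i \in s -> cintegral_is (A i) f (v i)) ->
  cintegral_is (\big[setU/set0]_(i <- s) A i) f (\sum_(i <- s) v i).
Proof.
move=> mA + tA; elim: s => [|i s IH].
  move=> _ _; rewrite !big_nil.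
  by split; split; rewrite ?integral_set0 ?raddf0 //; exact: integrable_set0.
move=> /andP[i_s us] h.
have [hRe hIm] : cintegral_is (\big[setU/set0]_(i <- s) A i) f
    (\sum_(i <- s) v i).
  by apply: IH => // j js; apply: h; rewrite inE js orbT.
have [iRe iIm] := h i (mem_head _ _).
have dA : [disjoint A i & \big[setU/set0]_(i <- s) A i].
  apply/eqP; rewrite big_distrr /= big_seq big1// => j js.
  move/trivIsetP : tA; apply => //.
  by apply: contraNneq i_s => ->.
have mU := bigsetU_measurable (P := xpredT) s (fun j _ => mA j).
by rewrite !big_cons; split; rewrite raddfD; apply: integral_isU.
Qed.

End ComplexIntegral.

(** * One step of the walk and of the process *)

Lemma imaginary_exp_mod4 (R : realType) (a : nat) :
  'i%C ^+ (a %% 4) = 'i%C ^+ a :> R[i].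
Proof.
rewrite {2}(divn_eq a 4) exprD mulnC exprM.
have -> : 'i%C ^+ 4 = 1 :> R[i] by rewrite (exprM _ 2 2) sqr_i sqrrN expr1n.
by rewrite expr1n mul1r.
Qed.

(** The outermost step of the iteration reads the amplitudes at [y - sgn w],
    the next position of the process; this is why the process moves against
    the walk. *)
Lemma walkS (R : realType) (Theta : int -> R) (psi0 : state R) m y w :
  let y' := y - sgn w in
  walk Theta psi0 m.+1 y w =
  (cos (Theta y'))%:C * walk Theta psi0 m y' w +
  'i%C * (sin (Theta y'))%:C * walk Theta psi0 m y' (~~ w).
Proof.
rewrite /walk iterS /walk_op /shift_op /coin_op /=.
rewrite (bigD1 w) //= (bigD1 (~~ w)) /=; last by case: w.
rewrite big1 ?addr0; last by case: w => -[].
by rewrite !mxE; case: w.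
Qed.

Section ProcessSteps.
Variables (T : Type) (N : nat -> T -> nat) (z : spin).

Lemma procSS k w : procS N k.+1 w = ((procS N k w + N k.+1 w) %% 4)%N.
Proof. by rewrite /procS big_nat_recr //= modnDml. Qed.

Lemma procZS k w :
  procZ N z k.+1 w = odd (N k.+1 w %% 4) (+) procZ N z k w.
Proof.
by rewrite /procZ procSS !odd_mod// oddD -addbA addbCA /procS !odd_mod.
Qed.

End ProcessSteps.

Section Filtration.
Context d (T : measurableType d) (R : realType) (P : probability T R).
Variable N : nat -> {RV P >-> nat}.

Lemma natural_filtration_sub_measurable k A :
  natural_filtration N k A -> measurable A.
Proof.
apply: smallest_sub; first exact: sigma_algebra_measurable.
elim/big_ind : _ => //.
  by move=> A1 A2 h1 h2 X [/h1|/h2].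
by move=> i _ X [B mB <-]; exact: measurable_funP.
Qed.

Lemma natural_filtration_split k A B :
  natural_filtration N k A -> natural_filtration N k.+1 (A `&` N k.+1 @^-1` B).
Proof.
move=> FA; rewrite /natural_filtration /g_sigma_preimage big_ord_recr /=.
set G := _ `|` _; apply: (@measurableI _ (g_sigma_algebraType G)).
  by apply: (sub_sigma_algebra2 _ FA); exact: subsetUl.
by apply: sub_sigma_algebra; right; exists B => //; rewrite setTI.
Qed.

End Filtration.

(** * Integration over the branches of the process *)

Section Branches.
Context (R : realType) (Theta : int -> R) (psi0 : state R)
    (x : int) (z : spin) (d : measure_display) (T : measurableType d)
    (P : probability T R) (N : nat -> {RV P >-> nat}).
Hypothesis hN : forall j : nat, (1 <= j)%N ->
  cond_poisson P (natural_filtration N j.-1) (N j)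
    (fun w => Theta (procX N x z j w)).

Definition rate_sum k w : R := \sum_(1 <= j < k.+1) Theta (procX N x z j w).

Definition path_functional n (w : T) : R[i] :=
  'i%C ^+ procS N n w * (expR (rate_sum n w))%:C *
  psi0 (procX N x z n w) (procZ N z n w).

(** On an event of the past on which the next rate is the constant [th], the
    conditional Poisson law has a constant kernel, so that integrating it
    factors out the probability of the event. *)
Lemma conditional_mass k A th (B : set nat) :
  natural_filtration N k A ->
  (forall w, A w -> Theta (procX N x z k.+1 w) = th) ->
  fine (P (A `&` N k.+1 @^-1` B)) = fine (P A) * poisson_mass th B.
Proof.
move=> FA Ath; have mA := natural_filtration_sub_measurable FA.
have [_ /(_ B I)[_ /(_ A FA) ->]] := hN (ltn0Sn k).
rewrite (eq_integral (cst (poisson_prob th 0 B))); last first.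
  by move=> w /set_mem Aw; rewrite Ath.
by rewrite integral_cst// fineM ?fin_num_measure// mulrC.
Qed.

Lemma rate_ge0 k A th :
  natural_filtration N k A ->
  (forall w, A w -> Theta (procX N x z k.+1 w) = th) ->
  0 <= th \/ fine (P A) = 0.
Proof.
move=> FA Ath; have mA := natural_filtration_sub_measurable FA.
have [th0|th0] := leP 0 th; [by left|right].
have [ae0 _] := hN (ltn0Sn k).
suff: P.-negligible A by move=> /measure_negligible ->.
by apply: negligibleS ae0 => w Aw /=; rewrite Ath// leNgt th0.
Qed.

(** Backward induction on [m]: a branch at time [k] with [m.+1] steps left is
    cut by [N_{k+1}] modulo 4 into four branches with [m] steps left, and
    [poisson_twist] reassembles their contributions into one step of the
    walk. *)
Lemma path_functional_integral m k A S L X Z :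
  natural_filtration N k A ->
  (forall w, A w -> [/\ procS N k w = S, rate_sum k w = L,
     procX N x z k w = X & procZ N z k w = Z]) ->
  cintegral_is P A (path_functional (k + m))
    ((fine (P A))%:C * ('i%C ^+ S * (expR L)%:C * walk Theta psi0 m X Z)).
Proof.
elim: m k A S L X Z => [|m IH] k A S L X Z FA Aw;
  have mA := natural_filtration_sub_measurable FA.
  have fc w : A w -> path_functional (k + 0) w =
      'i%C ^+ S * (expR L)%:C * walk Theta psi0 0 X Z.
    by move=> /Aw[hS hL hX hZ]; rewrite addn0 /path_functional hS hL hX hZ.
  set c := _ * _ * _ in fc *.
  have cE (p : R) : complex.Re (p%:C * c) = p * complex.Re c /\
                    complex.Im (p%:C * c) = p * complex.Im c.
    by case: c {fc} => a b /=; rewrite !mul0r subr0 addr0.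
  by rewrite /cintegral_is !(cE _).1 !(cE _).2; split;
     apply: integral_is_cst => // w /fc ->.
(* the position, hence the rate, at time k+1 is already known on A *)
pose X' := X - sgn Z; pose th := Theta X'.
pose A' r := A `&` N k.+1 @^-1` (residue4 r).
have X'E w : A w -> procX N x z k.+1 w = X'.
  by move=> /Aw[_ _ hX hZ]; rewrite procXS hX hZ.
have thE w : A w -> Theta (procX N x z k.+1 w) = th by move=> /X'E ->.
have AE : A = \big[setU/set0]_(r <- iota 0 4) A' r.
  rewrite -bigcup_seq; apply/seteqP; split => [w Aw'|w [r _ []]//].
  have r4 : (N k.+1 w %% 4)%N \in iota 0 4 by rewrite mem_iota ltn_mod.
  by exists (N k.+1 w %% 4)%N.
have A'int r : r \in iota 0 4 ->
    cintegral_is P (A' r) (path_functional (k + m.+1)) ((fine (P (A' r)))%:C *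
      ('i%C ^+ ((S + r) %% 4) * (expR (L + th))%:C *
       walk Theta psi0 m X' (odd r (+) Z))).
  move=> _; rewrite addnS -addSn; apply: IH.
    exact: natural_filtration_split.
  move=> w [Aw' hr]; have [hS hL hX hZ] := Aw w Aw'; split.
  - by rewrite procSS hS -modnDmr hr.
  - by rewrite /rate_sum big_nat_recr //= thE// -hL.
  - exact: X'E.
  - by rewrite procZS hr hZ.
have mA' r : measurable (A' r).
  exact: natural_filtration_sub_measurable (natural_filtration_split _ FA).
have tA' : trivIset [set: nat] A'.
  apply/trivIsetP => i j _ _ ij; apply/seteqP; split => // w [[_ wi] [_ wj]].
  by move: ij; rewrite -wi -wj eqxx.
have := cintegral_is_bigU mA' (iota_uniq 0 4) tA' A'int.
rewrite -AE; congr cintegral_is.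
under eq_bigr => r _ do
  rewrite (conditional_mass _ FA thE) imaginary_exp_mod4 exprD expRD
          !rmorphM /=.
(* for a negative rate the branch is null and both sides vanish *)
case: (rate_ge0 FA thE) => [th0|->]; last first.
  by rewrite mul0r big1// => r _; rewrite !mul0r.
rewrite walkS -/X' -/th.
rewrite -(poisson_twist (fun b => walk Theta psi0 m X' (b (+) Z)) th0).
rewrite !mulr_sumr; apply: eq_bigr => r _; ring.
Qed.

End Branches.

Theorem theorem5p9 (R : realType) (Theta : int -> R) (psi0 : state R)
    (hpsi0 : ell2 psi0) (x : int) (z : spin)
    (d : measure_display) (T : measurableType d) (P : probability T R)
    (N : nat -> {RV P >-> nat})
    (hN : forall j : nat, (1 <= j)%N ->
       cond_poisson P (natural_filtration N j.-1) (N j)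
         (fun w => Theta (procX N x z j w)))
    (n : nat) (hn : (1 <= n)%N) :
  let F := fun w : T =>
    'i%C ^+ procS N n w *
    (expR (\sum_(1 <= j < n.+1) Theta (procX N x z j w)))%:C *
    psi0 (procX N x z n w) (procZ N z n w) in
  cintegrable P F /\ walk Theta psi0 n x z = cexpectation P F.
Proof.
move=> F; have FT : natural_filtration N 0 [set: T].
  exact: (@measurableT _ (g_sigma_algebraType _)).
have start w : [set: T] w -> [/\ procS N 0 w = 0%N,
    \sum_(1 <= j < 1) Theta (procX N x z j w) = 0,
    procX N x z 0 w = x & procZ N z 0 w = z].
  by rewrite procX0 /procZ /procS !big_geq.
have [[iRe eRe] [iIm eIm]] := path_functional_integral psi0 hN n FT start.
split; first by split.
rewrite /cexpectation !unlock.
rewrite probability_setT expr0 expR0 !mul1r in eRe eIm.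
by rewrite [X in fine X +i* _]eRe [X in _ +i* fine X]eIm; case: walk.
Qed.
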